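(* Let $k \geq 2$ be an integer, let $R_1, \ldots, R_k$ be finite commutative rings with identity, and let $R$ be a ring with $R \cong R_1 \times \cdots \times R_k$. Let $I$ be the ideal of vanishing polynomials in $R[x]$, and for each $1 \leq i \leq k$ let $I_i$ be the ideal of vanishing polynomials in $R_i[x]$. Then $$I \cong I_1 \times \cdots \times I_k$$ (as rings, not necessarily with identity, the right-hand side having componentwise operations).
   Context: Rings are commutative with identity. For a ring $S$, a polynomial $F(x) \in S[x]$ (a formal polynomial) is called a vanishing polynomial if $F(a) = 0$ for all $a \in S$; the zero polynomial is a vanishing polynomial. The set of vanishing polynomials in $S[x]$ is an ideal of $S[x]$, and an ideal is regarded as a ring (possibly without identity) under the operations of $S[x]$. *)

(* Defs.v *)
From HB Require Import structures.
From mathcomp Require Import all_boot all_algebra.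
From mathcomp Require Import finmap monalg.
From mathcomp Require Import boolp.

Set Implicit Arguments.
Unset Strict Implicit.
Unset Printing Implicit Defensive.

Import GRing.Theory.

Local Open Scope ring_scope.

(* Rings need not satisfy 1 != 0, hence comPzRingType throughout.  As {poly S}
   is only available when 1 != 0 in S, S[x] is defined here for an arbitrary
   commutative ring S, as the finitely supported functions nat -> S with the
   Cauchy product; fpoly_agrees_with_poly below shows that this is {poly S},
   with the same evaluation, as soon as S is nontrivial. *)
Definition fpoly (S : comPzRingType) := {malg S[nat]}.

HB.instance Definition _ (S : comPzRingType) := GRing.Zmodule.on (fpoly S).

Section FormalPolynomials.
Variable S : comPzRingType.
Implicit Types (p q r : fpoly S) (a c d : S).

Definition fpoly_one : fpoly S := << 1 *g 0%N >>.

(* The support condition only ensures finiteness: see coef_fpoly_mul. *)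
Definition fpoly_mul p q : fpoly S :=
  [malg n in [fset (i + j)%N | i in msupp p, j in msupp q]%fset =>
     \sum_(i < n.+1) p@_(i : nat) * q@_(n - i)%N].

Definition feval p a : S := \sum_(i <- msupp p) p@_i * a ^+ i.

Lemma coef_fpoly_mul p q n :
  (fpoly_mul p q)@_n = \sum_(i < n.+1) p@_(i : nat) * q@_(n - i)%N.
Proof.
rewrite mcoeffE; case: ifP => // /negbT nD; rewrite big1 // => i _.
have [ip|/mcoeff_outdom->] := boolP (nat_of_ord i \in msupp p);
  last by rewrite mul0r.
have [jq|/mcoeff_outdom->] := boolP ((n - i)%N \in msupp q);
  last by rewrite mulr0.
case/negP: nD; apply/imfset2P; exists (nat_of_ord i) => //.
by exists (n - i)%N => //; rewrite subnKC // -ltnS.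
Qed.

Lemma coef_fpoly_one n : fpoly_one@_n = (n == 0%N)%:R.
Proof. by rewrite mcoeffU eq_sym. Qed.

Fact fpoly_mulC : commutative fpoly_mul.
Proof.
move=> p q; apply/malgP => n; rewrite !coef_fpoly_mul.
rewrite (reindex_inj rev_ord_inj) /=; apply: eq_bigr => i _.
by rewrite mulrC subSS (sub_ordK i).
Qed.

Fact fpoly_mul1 : left_id fpoly_one fpoly_mul.
Proof.
move=> p; apply/malgP => n; rewrite coef_fpoly_mul big_ord_recl subn0.
rewrite big1 ?addr0 => [|i _]; rewrite coef_fpoly_one ?mul1r //.
by rewrite mul0r.
Qed.

Fact fpoly_mulDl : left_distributive fpoly_mul +%R.
Proof.
move=> p q r; apply/malgP => n; rewrite mcoeffD !coef_fpoly_mul -big_split.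
by apply: eq_bigr => i _; rewrite mcoeffD mulrDl.
Qed.

Let coef_mul_rev p q n :
  (fpoly_mul p q)@_n = \sum_(i < n.+1) p@_(n - i)%N * q@_(i : nat).
Proof.
by rewrite fpoly_mulC coef_fpoly_mul; apply: eq_bigr => i _; rewrite mulrC.
Qed.

Fact fpoly_mulA : associative fpoly_mul.
Proof.
move=> p q r; apply/malgP => n; rewrite coef_fpoly_mul coef_mul_rev.
pose coef3 j k := p@_(j : nat) * (q@_(n - j - k)%N * r@_(k : nat)).
transitivity (\sum_(j < n.+1) \sum_(k < n.+1 | (k <= n - j)%N) coef3 j k).
  apply: eq_bigr => /= j _; rewrite coef_mul_rev big_distrr /=.
  by rewrite (big_ord_narrow_leq (leq_subr _ _)).
rewrite (exchange_big_dep predT) //=; apply: eq_bigr => k _.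
transitivity (\sum_(j < n.+1 | (j <= n - k)%N) coef3 j k).
  apply: eq_bigl => j; rewrite -ltnS -(ltnS j) -!subSn ?leq_ord //.
  by rewrite -subn_gt0 -(subn_gt0 j) -!subnDA addnC.
rewrite (big_ord_narrow_leq (leq_subr _ _)) coef_fpoly_mul big_distrl /=.
by apply: eq_bigr => j _; rewrite /coef3 -!subnDA addnC mulrA.
Qed.

HB.instance Definition _ := GRing.Zmodule_isComPzRing.Build (fpoly S)
  fpoly_mulA fpoly_mulC fpoly_mul1 fpoly_mulDl.

Lemma fpoly_sumE p : p = \sum_(i <- msupp p) (<< p@_i *g i >> : fpoly S).
Proof. exact: monalgEw (fsubset_refl _). Qed.

Lemma fpoly_mulU c d i j :
  (<< c *g i >> : fpoly S) * << d *g j >> = << c * d *g (i + j)%N >>.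
Proof.
apply/malgP => n; rewrite coef_fpoly_mul mcoeffU.
have [<-|neq] := eqVneq.
  have lt_i : (i < (i + j).+1)%N by rewrite ltnS leq_addr.
  rewrite (bigD1 (Ordinal lt_i)) //= addKn !mcoeffU !eqxx big1 ?addr0 //.
  move=> k; rewrite -val_eqE /= eq_sym => /negPf ik.
  by rewrite mcoeffU ik mul0r.
rewrite big1 // => k _; rewrite !mcoeffU.
have [ik|] := eqVneq i k; last by rewrite mul0r.
have [jk|] := eqVneq j (n - k)%N; last by rewrite mulr0.
by case/eqP: neq; rewrite jk ik subnKC // -ltnS.
Qed.

Lemma feval_wide (D : {fset nat}) p a :
  (msupp p `<=` D)%fset -> feval p a = \sum_(i <- D) p@_i * a ^+ i.
Proof.
move=> sD; apply: big_fset_incl => // i _ /mcoeff_outdom ->.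
by rewrite mul0r.
Qed.

Lemma fevalU c i a : feval << c *g i >> a = c * a ^+ i.
Proof. by rewrite (feval_wide _ msuppU_le) big_seq_fset1 mcoeffUU. Qed.

Lemma feval0 a : feval 0 a = 0.
Proof. by rewrite /feval msupp0 big_seq_fset0. Qed.

Lemma fevalD p q a : feval (p + q) a = feval p a + feval q a.
Proof.
rewrite (feval_wide _ (msuppD_le p q)).
rewrite (feval_wide _ (fsubsetUl (msupp p) (msupp q))).
rewrite (feval_wide _ (fsubsetUr (msupp p) (msupp q))) -big_split /=.
by apply: eq_bigr => i _; rewrite mcoeffD mulrDl.
Qed.

Lemma fevalN p a : feval (- p) a = - feval p a.
Proof. by apply/eqP; rewrite -addr_eq0 -fevalD addNr feval0. Qed.

Lemma feval_sum I (s : seq I) (F : I -> fpoly S) a :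
  feval (\sum_(i <- s) F i) a = \sum_(i <- s) feval (F i) a.
Proof.
exact: (big_morph (fun p => feval p a) (fun p q => fevalD p q a) (feval0 a)).
Qed.

Lemma fevalM p q a : feval (p * q) a = feval p a * feval q a.
Proof.
rewrite {1}(fpoly_sumE p) {1}(fpoly_sumE q) big_distrl feval_sum /=.
rewrite [in RHS]/feval big_distrl /=; apply: eq_bigr => i _.
rewrite !big_distrr feval_sum /=; apply: eq_bigr => j _.
by rewrite fpoly_mulU fevalU exprD mulrACA.
Qed.

Definition vanishing : {pred fpoly S} :=
  [pred p | `[< forall a, feval p a = 0 >]].

Lemma vanishingP p : reflect (forall a, feval p a = 0) (p \in vanishing).
Proof. exact: asboolP. Qed.

Fact vanishing_zmod_closed : zmod_closed vanishing.
Proof.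
split=> [|p q /vanishingP p0 /vanishingP q0]; apply/vanishingP => a.
  exact: feval0.
by rewrite fevalD fevalN p0 q0 subr0.
Qed.

HB.instance Definition _ :=
  GRing.isZmodClosed.Build (fpoly S) vanishing vanishing_zmod_closed.

Lemma vanishingMl p q : q \in vanishing -> p * q \in vanishing.
Proof.
by move=> /vanishingP q0; apply/vanishingP => a; rewrite fevalM q0 mulr0.
Qed.

End FormalPolynomials.

Theorem fpoly_agrees_with_poly (S : comNzRingType) :
  exists f : {rmorphism fpoly S -> {poly S}},
    bijective f /\ forall p a, (f p).[a] = feval p a.
Proof.
pose f (p : fpoly S) : {poly S} := \sum_(i <- msupp p) p@_i *: 'X^i.
have coef_f p n : (f p)`_n = p@_n.
  rewrite coef_sum.
  transitivity (\sum_(i <- msupp p | i == n) p@_i).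
    rewrite [RHS]big_mkcond; apply: eq_bigr => i _.
    by rewrite coefZ coefXn eq_sym; case: ifP => _; rewrite ?mulr1 ?mulr0.
  have [n_p|n_p] := msuppP.
    by rewrite -big_filter filter_pred1_uniq ?fset_uniq // big_seq1.
  by rewrite big1_seq // => i /andP[/eqP-> n_in]; rewrite n_in in n_p.
have fB : zmod_morphism f.
  by move=> p q; apply/polyP => n; rewrite coefB !coef_f mcoeffB.
have fM : monoid_morphism f.
  split=> [|p q]; apply/polyP => n; rewrite ?coef1 ?coefM coef_f.
    exact: coef_fpoly_one.
  by rewrite coef_fpoly_mul; apply: eq_bigr => i _; rewrite !coef_f.
pose zf := GRing.isZmodMorphism.Build _ _ f fB.
pose mf := GRing.isMonoidMorphism.Build _ _ f fM.
pose F : {rmorphism fpoly S -> {poly S}} := HB.pack f zf mf.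
exists F; split=> [|p a]; last first.
  rewrite /= /f horner_sum; apply: eq_bigr => i _.
  by rewrite hornerZ hornerXn.
pose g (P : {poly S}) : fpoly S := \sum_(i < size P) << P`_i *g (i : nat) >>.
have coef_g P n : (g P)@_n = P`_n.
  rewrite raddf_sum /=.
  have [ltn|gen] := ltnP n (size P); last first.
    rewrite nth_default // big1 // => i _; rewrite mcoeffU.
    by have [eq_i|//] := eqVneq; rewrite -eq_i leqNgt ltn_ord in gen.
  rewrite (bigD1 (Ordinal ltn)) //= mcoeffUU big1 ?addr0 // => i.
  by rewrite -val_eqE mcoeffU => /negPf /= ->.
exists g => [p|P]; first by apply/malgP => n; rewrite coef_g coef_f.
by apply/polyP => n; rewrite coef_f coef_g.
Qed.

(* Rings that need not have an identity. *)
HB.mixin Record Zmodule_isRng A of GRing.Zmodule A := {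
  rng_mul : A -> A -> A;
  rng_mulA : associative rng_mul;
  rng_mulDl : left_distributive rng_mul +%R;
  rng_mulDr : right_distributive rng_mul +%R
}.

#[short(type="rngType")]
HB.structure Definition Rng := {A of Zmodule_isRng A & GRing.Zmodule A}.

Definition rng_isomorphic (A B : rngType) : Prop :=
  exists f : A -> B, [/\ bijective f, {morph f : x y / x + y}
                       & {morph f : x y / rng_mul x y}].

Definition ring_isomorphic (A B : pzRingType) : Prop :=
  exists f : {rmorphism A -> B}, bijective f.

Record van_ideal (S : comPzRingType) := VanIdeal {
  van_val :> fpoly S;
  van_valP : van_val \in @vanishing S
}.

Section VanishingIdeal.
Variable S : comPzRingType.
Implicit Types p q r : van_ideal S.

HB.instance Definition _ := [isSub for @van_val S].
HB.instance Definition _ := [Choice of van_ideal S by <:].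
HB.instance Definition _ := [SubChoice_isSubZmodule of van_ideal S by <:].

Definition van_mul p q : van_ideal S :=
  VanIdeal (vanishingMl (p : fpoly S) (van_valP q)).

Fact van_mulA : associative van_mul.
Proof. by move=> p q r; apply/val_inj; rewrite /= mulrA. Qed.

Fact van_mulDl : left_distributive van_mul +%R.
Proof. by move=> p q r; apply/val_inj; rewrite /= mulrDl. Qed.

Fact van_mulDr : right_distributive van_mul +%R.
Proof. by move=> p q r; apply/val_inj; rewrite /= mulrDr. Qed.

HB.instance Definition _ := Zmodule_isRng.Build (van_ideal S)
  van_mulA van_mulDl van_mulDr.

End VanishingIdeal.

Definition fprod_of (I : finType) (T : I -> choiceType) :=
  {dffun forall i : I, T i}.

HB.instance Definition _ (I : finType) (T : I -> choiceType) :=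
  Choice.on (fprod_of T).

Section ProductZmodule.
Variables (I : finType) (V : I -> zmodType).
Implicit Types x y z : fprod_of V.

Definition fprod_zero : fprod_of V := [ffun i => 0].
Definition fprod_opp x : fprod_of V := [ffun i => - x i].
Definition fprod_add x y : fprod_of V := [ffun i => x i + y i].

Fact fprod_addA : associative fprod_add.
Proof. by move=> x y z; apply/ffunP => i; rewrite !ffunE addrA. Qed.
Fact fprod_addC : commutative fprod_add.
Proof. by move=> x y; apply/ffunP => i; rewrite !ffunE addrC. Qed.
Fact fprod_add0 : left_id fprod_zero fprod_add.
Proof. by move=> x; apply/ffunP => i; rewrite !ffunE add0r. Qed.
Fact fprod_addN : left_inverse fprod_zero fprod_opp fprod_add.
Proof. by move=> x; apply/ffunP => i; rewrite !ffunE addNr. Qed.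

HB.instance Definition _ := GRing.isZmodule.Build (fprod_of V)
  fprod_addA fprod_addC fprod_add0 fprod_addN.

End ProductZmodule.

Section ProductRng.
Variables (I : finType) (A : I -> rngType).
Implicit Types x y z : fprod_of A.

Definition fprod_rng_mul x y : fprod_of A := [ffun i => rng_mul (x i) (y i)].

Fact fprod_rng_mulA : associative fprod_rng_mul.
Proof. by move=> x y z; apply/ffunP => i; rewrite !ffunE rng_mulA. Qed.
Fact fprod_rng_mulDl : left_distributive fprod_rng_mul +%R.
Proof. by move=> x y z; apply/ffunP => i; rewrite !ffunE rng_mulDl. Qed.
Fact fprod_rng_mulDr : right_distributive fprod_rng_mul +%R.
Proof. by move=> x y z; apply/ffunP => i; rewrite !ffunE rng_mulDr. Qed.

HB.instance Definition _ := Zmodule_isRng.Build (fprod_of A)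
  fprod_rng_mulA fprod_rng_mulDl fprod_rng_mulDr.

End ProductRng.

Section ProductRing.
Variables (I : finType) (A : I -> pzRingType).
Implicit Types x y z : fprod_of A.

Definition fprod_one : fprod_of A := [ffun i => 1].
Definition fprod_mul x y : fprod_of A := [ffun i => x i * y i].

Fact fprod_mulA : associative fprod_mul.
Proof. by move=> x y z; apply/ffunP => i; rewrite !ffunE mulrA. Qed.
Fact fprod_mul1 : left_id fprod_one fprod_mul.
Proof. by move=> x; apply/ffunP => i; rewrite !ffunE mul1r. Qed.
Fact fprod_mulr1 : right_id fprod_one fprod_mul.
Proof. by move=> x; apply/ffunP => i; rewrite !ffunE mulr1. Qed.
Fact fprod_mulDl : left_distributive fprod_mul +%R.
Proof. by move=> x y z; apply/ffunP => i; rewrite !ffunE mulrDl. Qed.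
Fact fprod_mulDr : right_distributive fprod_mul +%R.
Proof. by move=> x y z; apply/ffunP => i; rewrite !ffunE mulrDr. Qed.

HB.instance Definition _ := GRing.Zmodule_isPzRing.Build (fprod_of A)
  fprod_mulA fprod_mul1 fprod_mulr1 fprod_mulDl fprod_mulDr.

End ProductRing.

Definition ring_prod (I : finType) (A : I -> pzRingType) : pzRingType :=
  fprod_of A.

Definition rng_prod (I : finType) (A : I -> rngType) : rngType :=
  fprod_of A.

(* Main.v *)
(* Reduction of coefficients in each factor identifies R[x] with the product of
   the R_i[x], compatibly with evaluation.  Since every element of R_i is the
   i-th component of an element of R, a polynomial over R vanishes on R if and
   only if each of its components vanishes on the corresponding R_i. *)
Require Import Defs.
From HB Require Import structures.
From mathcomp Require Import all_boot all_algebra.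
From mathcomp Require Import finmap monalg.

Set Implicit Arguments.
Unset Strict Implicit.
Unset Printing Implicit Defensive.

Import GRing.Theory.

Local Open Scope ring_scope.

Section MapPolynomial.
Variables (S T : comPzRingType) (f : {rmorphism S -> T}).
Implicit Types p q : fpoly S.

(** [msupp p] is only an upper bound for the support of the image, as [f] may kill nonzero
    coefficients. *)
Definition map_fpoly p : fpoly T := [malg n in msupp p => f p@_n].

Lemma coef_map_fpoly p n : (map_fpoly p)@_n = f p@_n.
Proof.
by rewrite mcoeffE; case: ifPn => // /mcoeff_outdom ->; rewrite rmorph0.
Qed.

Lemma map_fpolyD p q : map_fpoly (p + q) = map_fpoly p + map_fpoly q.
Proof. by apply/malgP => n; rewrite mcoeffD !coef_map_fpoly mcoeffD rmorphD. Qed.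

Lemma map_fpolyM p q : map_fpoly (p * q) = map_fpoly p * map_fpoly q.
Proof.
apply/malgP => n; rewrite coef_map_fpoly !coef_fpoly_mul rmorph_sum.
by apply: eq_bigr => i _; rewrite rmorphM !coef_map_fpoly.
Qed.

Lemma feval_map_fpoly p a : feval (map_fpoly p) (f a) = f (feval p a).
Proof.
have supp_map : (msupp (map_fpoly p) `<=` msupp p)%fset.
  apply/fsubsetP => n; apply: contraTT => n_p.
  by rewrite -mcoeff_eq0 coef_map_fpoly mcoeff_outdom // rmorph0.
(* Both evaluations become sums over [msupp p]; the indices added on the left carry zero
   coefficients. *)
rewrite (feval_wide _ supp_map) rmorph_sum; apply: eq_bigr => i _.
by rewrite coef_map_fpoly rmorphM rmorphXn.
Qed.

End MapPolynomial.

(** Surjectivity turns every evaluation point of [T] into some [f a], where the value is the image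
    of the value of [p] at [a]. *)
Lemma map_fpoly_vanishing (S T : comPzRingType) (f : {rmorphism S -> T})
    (p : fpoly S) :
  (forall b, exists a, f a = b) -> p \in @vanishing S ->
  map_fpoly f p \in @vanishing T.
Proof.
move=> f_surj /vanishingP p0; apply/vanishingP => b.
by have [a <-] := f_surj b; rewrite feval_map_fpoly p0 rmorph0.
Qed.

Section Product.
Variables (I : finType) (A : I -> comPzRingType).

Definition ring_proj i (x : ring_prod A) : A i := x i.

Fact ring_proj_zmod_morphism i : zmod_morphism (@ring_proj i).
Proof. by move=> x y; rewrite /ring_proj !ffunE. Qed.

Fact ring_proj_monoid_morphism i : monoid_morphism (@ring_proj i).
Proof. by split=> [|x y]; rewrite /ring_proj ffunE. Qed.

HB.instance Definition _ i := GRing.isZmodMorphism.Build _ _ (@ring_proj i)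
  (@ring_proj_zmod_morphism i).
HB.instance Definition _ i := GRing.isMonoidMorphism.Build _ _ (@ring_proj i)
  (@ring_proj_monoid_morphism i).

Lemma ring_proj_surj i (b : A i) : exists x, ring_proj i x = b.
Proof.
(* The tuple with [b] in position [i] and 0 elsewhere. *)
exists [ffun j => dfwith (fun j => 0 : A j) b j : A j].
by rewrite /ring_proj ffunE dfwith_in.
Qed.

Variables (R : comPzRingType) (f : {rmorphism R -> ring_prod A}).
Variable g : ring_prod A -> R.
Hypotheses (fK : cancel f g) (gK : cancel g f).

Let comp i : {rmorphism R -> A i} := @ring_proj i \o f.

Let comp_surj i (b : A i) : exists a, comp i a = b.
Proof. by have [x <-] := ring_proj_surj b; exists (g x); rewrite /= gK. Qed.

(** Inverse to reduction of coefficients: the n-th coefficients of all the [P i] form a tuple, which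
    [g] carries back to [R]. The union of the supports is finite because [I] is. *)
Definition fpoly_glue (P : forall i, fpoly (A i)) : fpoly R :=
  [malg n in (\bigcup_(i <- enum I) msupp (P i))%fset => g [ffun i => (P i)@_n]].

Let comp_coef_glue P n i : comp i (fpoly_glue P)@_n = (P i)@_n.
Proof.
rewrite mcoeffE; case: ifPn => [_|n_P]; first by rewrite /= gK /ring_proj ffunE.
(* Outside the union of the supports, both sides are zero. *)
rewrite rmorph0 mcoeff_outdom //; apply: contra n_P => n_Pi.
by apply/bigfcupP; exists i; rewrite // mem_enum.
Qed.

(** Equalities in [R] can be checked componentwise, since [f] is injective. *)
Let eq_comp a b : (forall i, comp i a = comp i b) -> a = b.
Proof. by move=> eq_ab; apply: (can_inj fK); apply/ffunP. Qed.

Let map_glue P i : map_fpoly (comp i) (fpoly_glue P) = P i.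
Proof. by apply/malgP => n; rewrite coef_map_fpoly comp_coef_glue. Qed.

Lemma fpoly_glue_vanishing (P : forall i, fpoly (A i)) :
  (forall i, P i \in @vanishing (A i)) -> fpoly_glue P \in @vanishing R.
Proof.
move=> P0; apply/vanishingP => a; apply: eq_comp => i.
(* The i-th component of the value at [a] is the value of [P i] at [comp i a]. *)
by rewrite -feval_map_fpoly map_glue rmorph0; apply/vanishingP.
Qed.

Lemma van_ideal_prod :
  rng_isomorphic (van_ideal R) (rng_prod (fun i => van_ideal (A i))).
Proof.
pose F (p : van_ideal R) : rng_prod (fun i => van_ideal (A i)) :=
  [ffun i => VanIdeal (map_fpoly_vanishing (@comp_surj i) (van_valP p))].
pose G (P : rng_prod (fun i => van_ideal (A i))) : van_ideal R :=
  VanIdeal (fpoly_glue_vanishing (fun i => van_valP (P i))).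
exists F; split.
- exists G => [p|P].
    (* [G (F p)] and [p] are compared coefficient by coefficient, and each coefficient component by
       component. *)
    apply/val_inj/malgP => n; apply: eq_comp => i.
    transitivity (van_val (F p i))@_n; first exact: comp_coef_glue.
    by rewrite ffunE coef_map_fpoly.
  by apply/ffunP => i; apply/val_inj; rewrite ffunE /= map_glue.
- by move=> p q; apply/ffunP => i; apply/val_inj; rewrite !ffunE /= map_fpolyD.
- by move=> p q; apply/ffunP => i; apply/val_inj; rewrite !ffunE /= map_fpolyM.
Qed.

End Product.

Local Close Scope ring_scope.

Theorem theorem1 (k : nat) (hk : 2 <= k)
    (R_ : 'I_k -> finComPzRingType) (R : comPzRingType)
    (hR : ring_isomorphic R (ring_prod (fun i : 'I_k => R_ i))) :
  rng_isomorphic (van_ideal R) (rng_prod (fun i : 'I_k => van_ideal (R_ i))).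
Proof.
have [f [g fK gK]] := hR.
exact: (@van_ideal_prod _ (fun i => R_ i) R f g fK gK).
Qed.
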